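(* Let $(\Omega,\mathcal{F},\mathbb{P})$ be a complete probability space and let $E$ be a Polish space. For a closed-valued Effros measurable mapping $S:\Omega\rightrightarrows E$ let $X_S\subset L^0(E)$ denote the set of measurable selections of $S$. Then to every stable and sequentially closed set $X\subset L^0(E)$ one can associate a closed-valued and Effros measurable mapping $S_X:\Omega\rightrightarrows E$ such that the following reciprocality relations hold: $$X=X_{S_X}\quad\text{for every stable and sequentially closed set }X\subset L^0(E),$$ and $$S=S_{X_S}\quad\text{for every closed-valued and Effros measurable mapping }S:\Omega\rightrightarrows E,$$ where $S_{X_S}$ is the mapping associated with the set $X=X_S$ (which is stable and sequentially closed), and equality of set-valued mappings is understood almost surely.
   Context: $L^0(E)$ is the set of Borel measurable functions $x:\Omega\to E$, identified if they coincide a.s. For a countable partition $(A_k)$ of $\Omega$ with $A_k\in\mathcal{F}$ and a sequence $(x_k)$ in $L^0(E)$, $\sum_k1_{A_k}x_k$ is the element of $L^0(E)$ equal to $x_k$ on $A_k$. A set $X\subset L^0(E)$ is stable if $X\ne\emptyset$ and $\sum_k1_{A_k}x_k\in X$ for every such partition and every sequence $(x_k)$ in $X$. It is sequentially closed if it contains every $x\in L^0(E)$ for which there is a sequence $(x_k)$ in $X$ with $x_k\to x$ a.s. A set-valued mapping $S:\Omega\rightrightarrows E$ is closed-valued if $S(\omega)\subset E$ is closed for all $\omega$; it is Effros measurable if $S^{-1}(O):=\{\omega\in\Omega:S(\omega)\cap O\ne\emptyset\}\in\mathcal{F}$ for all open $O\subset E$. It is always assumed that $S^{-1}(E)=\Omega$,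 i.e. $S(\omega)\neq\emptyset$ for all $\omega$. Two closed-valued Effros measurable mappings $S_1,S_2$ are identified if $S_1(\omega)=S_2(\omega)$ for almost all $\omega$. A measurable selection of $S$ is a Borel function $x:\Omega\to E$ with $x(\omega)\in S(\omega)$ for all $\omega$ (in $X_S$ these are taken modulo a.s. equality). *)

(* Defs.v *)
From HB Require Import structures.
From mathcomp Require Import all_boot all_order all_algebra.
From mathcomp Require Import all_classical all_reals all_analysis.

Set Implicit Arguments.
Unset Strict Implicit.
Unset Printing Implicit Defensive.

Import Order.TTheory GRing.Theory Num.Theory.
Local Open Scope classical_set_scope.
Local Open Scope ring_scope.
Local Open Scope quotient_scope.

Definition separable_space (E : topologicalType) :=
  exists2 D : set E, countable D & dense D.

Definition is_distance (R : realType) (T : Type) (dist : T -> T -> R) :=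
  [/\ forall x y, 0 <= dist x y,
      forall x y, dist x y = 0 <-> x = y,
      forall x y, dist x y = dist y x &
      forall x y z, dist x z <= dist x y + dist y z].

Definition metrizes (R : realType) (E : topologicalType) (dist : E -> E -> R) :=
  forall (x : E) (A : set E),
    nbhs x A <-> exists2 e : R, 0 < e & [set y | dist x y < e] `<=` A.

Definition complete_distance (R : realType) (E : topologicalType)
    (dist : E -> E -> R) :=
  forall u : nat -> E,
    (forall e : R, 0 < e -> exists N : nat, forall m n : nat,
       (N <= m)%N -> (N <= n)%N -> dist (u m) (u n) < e) ->
    exists l : E, u n @[n --> \oo] --> l.

Definition polish (R : realType) (E : topologicalType) :=
  separable_space E /\
  exists dist : E -> E -> R,
    [/\ is_distance dist, metrizes dist & complete_distance dist].

Notation borelType E := (g_sigma_algebraType (@open E)).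

Section L0.
Context d (Omega : measurableType d) (R : realType) (P : probability Omega R)
  (E : ptopologicalType).

(* An element of L0 is a class modulo a.s. equality; when applied to w : Omega
   it stands for its canonical representative. *)
Definition L0 : Type := {mfun_ P, Omega >-> borelType E}.

Definition L0_fun (x : L0) : Omega -> E := aqEqMfun_to_fun x.

Definition L0_class (f : {mfun Omega >-> borelType E}) : L0 :=
  \pi_({mfun_ P, Omega >-> borelType E}) f.

Definition measurable_partition (A : nat -> set Omega) :=
  [/\ forall k, measurable (A k), trivIset setT A & \bigcup_k A k = setT].

(* y is the sum of the 1_{A_k} x_k; it exists and is unique by pasting_exists
   and pasting_unique below. *)
Definition is_pasting (A : nat -> set Omega) (x : nat -> L0) (y : L0) :=
  forall k, L0_fun y = L0_fun (x k) %[ae P in A k].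

Definition stable (X : set L0) :=
  X !=set0 /\
  forall (A : nat -> set Omega) (x : nat -> L0) (y : L0),
    measurable_partition A -> (forall k, X (x k)) -> is_pasting A x y -> X y.

Definition seq_closed (X : set L0) :=
  forall (x : nat -> L0) (y : L0), (forall n, X (x n)) ->
    (\forall w \ae P, L0_fun (x n) w @[n --> \oo] --> L0_fun y w) -> X y.

Definition closed_valued (S : Omega -> set E) := forall w, closed (S w).

Definition nonempty_valued (S : Omega -> set E) := forall w, S w !=set0.

Definition effros_measurable (S : Omega -> set E) :=
  forall O : set E, open O -> measurable [set w | S w `&` O !=set0].

Definition closed_effros (S : Omega -> set E) :=
  [/\ closed_valued S, nonempty_valued S & effros_measurable S].

Definition selections (S : Omega -> set E) : set L0 :=
  [set L0_class f | f in
    [set f : {mfun Omega >-> borelType E} | forall w, S w (f w)]].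

Lemma L0_classK f : L0_fun (L0_class f) = f %[ae P].
Proof.
by have /eqP := reprK (L0_class f); rewrite eqmodE => /asboolP.
Qed.

Lemma L0_fun_inj (x y : L0) : L0_fun x = L0_fun y %[ae P] -> x = y.
Proof.
move=> xy; rewrite -[x]reprK -[y]reprK.
by apply/eqP; rewrite eqmodE; apply/asboolP.
Qed.

Lemma pasting_exists A x : measurable_partition A -> exists y, is_pasting A x y.
Proof.
move=> [mA tA cA].
have Aex w : exists k, A k w by have : setT w by []; rewrite -cA => -[k _]; exists k.
pose k w := projT1 (cid (Aex w)).
have kA w : A (k w) w by exact: projT2 (cid (Aex w)).
have kE n w : A n w -> k w = n.
  by move=> Anw; apply: (tA _ _ I I); exists w.
pose g w : borelType E := L0_fun (x (k w)) w.
have mg : measurable_fun setT g.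
  move=> _ B mB; rewrite setTI.
  rewrite (_ : g @^-1` B = \bigcup_n (A n `&` L0_fun (x n) @^-1` B)).
    apply: bigcupT_measurable => n; apply: measurableI => //.
    by rewrite -[X in measurable X]setTI; exact: measurable_funP.
  apply/seteqP; split=> [w gw|w [n _ [Anw Bw]]]; first by exists (k w).
  by rewrite /preimage/= /g (kE n w Anw).
pose f : {mfun Omega >-> borelType E} := mfun_Sub (mem_set mg).
exists (L0_class f) => n; apply: filterS (L0_classK f) => w /(_ I) -> Anw.
by rewrite /f/= /g (kE n w Anw).
Qed.

Lemma pasting_unique A x y z : measurable_partition A ->
  is_pasting A x y -> is_pasting A x z -> y = z.
Proof.
move=> [_ _ cA] yA zA; apply: L0_fun_inj.
have yz n : L0_fun y = L0_fun z %[ae P in A n].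
  by apply: filterS2 (yA n) (zA n) => w /[swap] zw /[swap] Aw ->//; rewrite zw.
have := negligible_bigcup yz; apply: negligibleS => w /= yzw.
have : setT w by []; rewrite -cA => -[n _ Anw]; exists n => // yzn.
by apply: yzw => _; exact: yzn.
Qed.

End L0.

Arguments selections {d Omega R} P {E} S.

(* Main.v *)
(**
Fix a countable base (B_n) of E. For a stable X and each n, an exhaustion
argument gives z_n in X for which the event {z_n in B_n} is maximal, i.e.
contains almost surely {x in B_n} for every x in X. The mapping
S_X(w) := closure {z_n(w) : n} is then Effros measurable, and every x in X
takes values in S_X. Conversely a selection of S_X is an a.s. limit of pastings
of the z_n, hence belongs to X.

For the second relation it suffices that a closed-valued Effros measurable S is
determined a.s. by X_S. The Kuratowski--Ryll-Nardzewski theorem yields, for each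
n, a selection of S with values in closure B_n wherever S(w) meets B_n;
if X_S is contained in X_T, these selections take values in T a.s., and the
density of their values in S(w) forces S(w) to be contained in T(w) a.s.
*)
Require Import Defs.
From mathcomp Require Import all_boot all_order all_algebra.
From mathcomp Require Import all_classical all_reals all_analysis.
From mathcomp Require Import lra.

Set Implicit Arguments.
Unset Strict Implicit.
Unset Printing Implicit Defensive.

Import Order.TTheory GRing.Theory Num.Theory.
Local Open Scope classical_set_scope.
Local Open Scope ring_scope.

(** * Preliminaries: geometric radii, dense sequences, Borel measurability *)

Lemma exists_small_geometric (R : realType) (c e : R) : 0 < c -> 0 < e ->
  exists k, c * 2^-k < e.
Proof.
move=> c0 e0; exists (Num.bound (c / e)).
have := @upper_nthrootP R (c / e) _ (leqnn _).
by rewrite ltr_pdivrMr// mulrC ltr_pdivrMr.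
Qed.

Lemma separable_dense_seq (E : ptopologicalType) : separable_space E ->
  exists e : nat -> E, forall O, open O -> O !=set0 -> exists n, O (e n).
Proof.
move=> [D /countable_injP[g gD] dD].
pose Q n x := D x /\ g x = n.
exists (fun n => xget point (Q n)) => O oO O0.
have [x [Ox Dx]] := dD O O0 oO; exists (g x).
have [Dy yx] := xgetPex point (ex_intro (Q (g x)) x (conj Dx erefl)).
by rewrite (gD _ _ _ _ yx) // inE.
Qed.

(** [seqDU C] makes the cover disjoint, so [N w] is the first index [n] with [C n w]. All countable
    choices depending on [w] are made measurably in this way. *)
Lemma measurable_first_index d (Omega : measurableType d)
    (C : nat -> set Omega) :
  (forall n, measurable (C n)) -> (forall w, exists n, C n w) ->
  exists N : Omega -> nat,
    (forall w, C (N w) w) /\ (forall n, measurable [set w | N w = n]).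
Proof.
move=> mC cC.
have /choice[N NC] w : exists n, seqDU C n w.
  have [n Cnw] := cC w.
  have : (\bigcup_k C k) w by exists n.
  by rewrite seqDU_bigcup_eq => -[k _ ?]; exists k.
exists N; split=> [w|n]; first exact: subset_seqDU (NC w).
rewrite (_ : [set w | _] = seqDU C n); first exact: seqDU_measurable.
apply/seteqP; split=> [w /= <-//|w Cw /=].
by apply: (trivIset_seqDU C) => //; exists w.
Qed.

Lemma measurable_fun_borelP d (Omega : measurableType d) (E : ptopologicalType)
    (f : Omega -> borelType E) :
  (forall O : set E, open O -> measurable (f @^-1` O)) -> measurable_fun setT f.
Proof.
move=> fO.
have fG : preimage_set_system setT f (@open E) `<=` measurable.
  by move=> _ [U oU <-]; rewrite setTI; exact: fO.
exact: (@measurability _ _ Omega (borelType E) setT f (@open E) erefl fG).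
Qed.

Lemma measurable_preimage_open d (Omega : measurableType d)
    (E : ptopologicalType) (f : {mfun Omega >-> borelType E}) (O : set E) :
  open O -> measurable [set w | O (f w)].
Proof.
move=> oO; rewrite -[X in measurable X]setTI.
by apply: measurable_funP => //; exact: sub_sigma_algebra.
Qed.

(** * The topology of [E] through a compatible distance *)

Section metric.
Context (R : realType) (E : ptopologicalType) (dist : E -> E -> R).
Hypothesis distP : is_distance dist.
Hypothesis distE : metrizes dist.

Let dxx x : dist x x = 0. Proof. by have [_ h _ _] := distP; apply/h. Qed.
Let dC x y : dist x y = dist y x. Proof. by have [_ _ h _] := distP. Qed.
Let dD x y z : dist x z <= dist x y + dist y z.
Proof. by have [_ _ _ h] := distP. Qed.

Lemma open_dball x e : open [set y | dist x y < e].
Proof.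
rewrite openE => y /= xy; apply/distE; exists (e - dist x y).
  by rewrite subr_gt0.
by move=> z /= yz; have := dD x y z; lra.
Qed.

Lemma open_contains_dball (O : set E) x : open O -> O x ->
  exists2 e : R, 0 < e & [set y | dist x y < e] `<=` O.
Proof. by rewrite openE => h /h /distE. Qed.

Lemma closed_adherent (C : set E) x : closed C ->
  (forall e, 0 < e -> exists2 y, C y & dist x y < e) -> C x.
Proof.
move=> cC h; apply: cC => A /distE[e /h[y Cy xy] eA].
by exists y; split=> //; exact: eA.
Qed.

Lemma cvg_dist (u : nat -> E) l : u n @[n --> \oo] --> l <->
  (forall e, 0 < e -> exists N, forall n, (N <= n)%N -> dist l (u n) < e).
Proof.
split=> [ul e e0|h A /distE[e /h[N Nl] eA]].
  have /ul[N _ Nu] : nbhs l [set y | dist l y < e] by apply/distE; exists e.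
  by exists N => n /Nu.
by exists N => // n /= /Nl; exact: eA.
Qed.

Section dense_sequence.
Context (e : nat -> E).
Hypothesis e_dense : forall O, open O -> O !=set0 -> exists n, O (e n).

Lemma dense_seq_near x r : 0 < r -> exists n, dist (e n) x < r.
Proof.
move=> r0; have [|n /=] := e_dense (open_dball x r).
  by exists x; rewrite /= dxx.
by rewrite dC; exists n.
Qed.

(** * The Kuratowski--Ryll-Nardzewski selection theorem *)

Section selection.
Context d (Omega : measurableType d) (S : Omega -> set E).
Hypothesis dist_complete : complete_distance dist.
Hypothesis S_ce : closed_effros S.

(** An approximate selection of accuracy [2^-k], stored as the index of a point of the dense
    sequence, so that measurability only concerns countably many level sets. *)
Let near k (N : Omega -> nat) := (forall n, measurable [set w | N w = n]) /\
  forall w, S w `&` [set y | dist (e (N w)) y < 2^-k] !=set0.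

Let near0 : exists N, near 0 N.
Proof.
have [_ S0 Sm] := S_ce.
have [||N [NC mN]] := @measurable_first_index _ Omega
  (fun j => [set w | S w `&` [set y | dist (e j) y < 2^-0] !=set0]).
- by move=> n; apply: Sm; exact: open_dball.
- move=> w; have [s Ss] := S0 w.
  have [n ns] := dense_seq_near s (ltr01).
  by exists n, s; split=> //=; rewrite expr0 invr1.
- by exists N; split.
Qed.

(** The new ball is required to meet [S w] inside the old ball. A common point of both balls then
    bounds the distance between their centres. *)
Let nearS k N : near k N -> exists N', near k.+1 N' /\
  forall w, dist (e (N w)) (e (N' w)) < 2^-k + 2^-k.+1.
Proof.
move=> [mN SN]; have [_ _ Sm] := S_ce.
have [||N' [NC mN']] := @measurable_first_index _ Omega (fun j => [set w |
  S w `&` ([set y | dist (e (N w)) y < 2^-k] `&`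
           [set y | dist (e j) y < 2^-k.+1]) !=set0]).
(* The old ball moves with [w]. Splitting along the values [i] of [N] leaves a fixed open set, to
   which Effros measurability applies. *)
- move=> j; rewrite (_ : [set w | _] = \bigcup_i ([set w | N w = i] `&`
    [set w | S w `&` ([set y | dist (e i) y < 2^-k] `&`
           [set y | dist (e j) y < 2^-k.+1]) !=set0])).
    apply: bigcupT_measurable => i; apply: measurableI => //.
    by apply: Sm; apply: openI; exact: open_dball.
  by apply/seteqP; split=> [w h|w [i _ [/= <-]]//]; exists (N w).
- move=> w; have [s [Ss ks]] := SN w.
  have [|j js] := @dense_seq_near s (2^-k.+1).
    by rewrite invr_gt0 exprn_gt0.
  by exists j, s.
exists N'; split; first split=> // w.
  by have [s [Ss [_ ?]]] := NC w; exists s.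
move=> w; have [s [Ss [/= h1 h2]]] := NC w.
by have := dD (e (N w)) s (e (N' w)); rewrite [dist s _]dC; lra.
Qed.

(** Iterating [nearS] gives countably valued approximations that are Cauchy uniformly in [w]. Their
    limits exist by completeness and lie in [S w] because it is closed. *)
Lemma measurable_selection :
  exists f : {mfun Omega >-> borelType E}, forall w, S w (f w).
Proof.
have [Scl _ _] := S_ce; have [N0 N0near] := near0.
(* [step] must be total for [choice]; outside [near] it takes the irrelevant value [N0]. *)
have /choice[step stepP] (kN : nat * (Omega -> nat)) : exists N',
    near kN.1 kN.2 -> near kN.1.+1 N' /\
    forall w, dist (e (kN.2 w)) (e (N' w)) < 2^-kN.1 + 2^-kN.1.+1.
  have [/nearS[N' ?]|?] := pselect (near kN.1 kN.2); first by exists N'.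
  by exists N0.
pose idx := fix idx k := if k is j.+1 then step (j, idx j) else N0.
have idx_near k : near k (idx k).
  by elim: k => // k /(stepP (k, idx k)) [].
have r_gt0 k : 0 < 2^-k :> R by rewrite invr_gt0 exprn_gt0.
have rS k : 2^-k = 2^-k.+1 + 2^-k.+1 :> R.
  by rewrite exprS invfM; lra.
pose u w k := e (idx k w).
have uS w k : dist (u w k) (u w k.+1) < 2^-k + 2^-k.+1.
  by have [_ /(_ w)] := stepP (k, idx k) (idx_near k).
(* The steps telescope: 2^-k + 2^-k.+1 <= 4 * 2^-k - 4 * 2^-k.+1. *)
have uD w k m : dist (u w k) (u w (k + m)%N) <= 4 * 2^-k - 4 * 2^-(k + m).
  elim: m => [|m IH]; first by rewrite addn0 dxx subrr.
  rewrite addnS; have := dD (u w k) (u w (k + m)%N) (u w (k + m).+1).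
  have := uS w (k + m)%N; have := rS (k + m)%N; have := r_gt0 (k + m).+1.
  lra.
have u_le w k n : (k <= n)%N -> dist (u w k) (u w n) < 4 * 2^-k.
  move=> /subnKC <-; have := uD w k (n - k)%N.
  have := r_gt0 (k + (n - k))%N; lra.
have /choice[f fl] w : exists l : E, u w n @[n --> \oo] --> l.
  apply: dist_complete => eps eps0.
  have [//|k ke] := @exists_small_geometric R 8 eps _ eps0.
  exists k => m n /(u_le w) km /(u_le w) kn.
  by have := dD (u w m) (u w k) (u w n); rewrite [dist _ (u w k)]dC; lra.
(* The constant is [4 + 1]: [4 * 2^-k] from [u_le] and [2^-k] from convergence to [f w]. *)
have uf w k : dist (u w k) (f w) < 5 * 2^-k.
  have /cvg_dist/(_ _ (r_gt0 k))[n nl] := fl w.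
  have := nl _ (leq_maxl n k); have := u_le w _ _ (leq_maxr n k).
  have := dD (u w k) (u w (maxn n k)) (f w).
  rewrite [dist (u w (maxn n k)) _]dC; lra.
have Sf w : S w (f w).
  apply: closed_adherent => // eps eps0.
  (* Here [6 = 5 + 1]: [f w] is within [5 * 2^-k] of [u w k], which is within [2^-k] of a point of
     [S w]. *)
  have [//|k ke] := @exists_small_geometric R 6 eps _ eps0.
  have [_ /(_ w) [s [Ss /= us]]] := idx_near k.
  exists s => //; have := dD (f w) (u w k) s; have := uf w k.
  rewrite [dist (f w) (u w k)]dC; rewrite -/(u w k) in us; lra.
have mf : measurable_fun setT (f : Omega -> borelType E).
  apply: measurable_fun_borelP => O oO.
  (* By [uf], [f w] is in the ball of radius [5 * 2^-k] about [e (idx k w)]. Hence it lies in [O] as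
     soon as such a ball does, and conversely the ball lies in [O] once twice its radius,
     [10 * 2^-k], is small enough. *)
  rewrite (_ : f @^-1` O = \bigcup_k \bigcup_(n in
      [set n | [set y | dist (e n) y < 5 * 2^-k] `<=` O])
      [set w | idx k w = n]).
    apply: bigcupT_measurable => k; apply: bigcup_measurable => n _.
    by have [] := idx_near k.
  apply/seteqP; split=> [w /= Ofw|w [k _ [n /= nO wn]]]; last first.
    by apply: nO => /=; rewrite -wn; exact: uf.
  have [eps eps0 epsO] := open_contains_dball oO Ofw.
  have [//|k ke] := @exists_small_geometric R 10 eps _ eps0.
  exists k => //; exists (idx k w) => //= y /= ky; apply: epsO => /=.
  have := dD (f w) (u w k) y; have := uf w k.
  have : dist (u w k) y < 5 * 2^-k := ky.
  rewrite [dist (f w) (u w k)]dC; lra.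
by exists (mfun_Sub (mem_set mf)).
Qed.

End selection.

(** Balls with centres [e i] and radii [2^-k]. Control of the closures matters because selections
    can only be forced into [closure (B n)]. *)
Lemma countable_base_closure : exists B : nat -> set E,
  (forall n, open (B n)) /\
  forall O x, open O -> O x -> exists n, B n x /\ closure (B n) `<=` O.
Proof.
(* The default [(0, 0)] merely repeats one of the balls. *)
pose c n : nat * nat := odflt (0, 0)%N (unpickle n).
exists (fun n => [set y | dist (e (c n).1) y < 2^-(c n).2]).
split=> [n|O x oO Ox]; first exact: open_dball.
have [eps eps0 epsO] := open_contains_dball oO Ox.
have [//|k ke] := @exists_small_geometric R 3 eps _ eps0.
have r0 : 0 < 2^-k :> R by rewrite invr_gt0 exprn_gt0.
have [i ix] := dense_seq_near x r0.
exists (pickle (i, k)); rewrite /c pickleK /=; split=> // y yB.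
have [|b [/= ib yb]] := yB [set z | dist y z < 2^-k].
  by apply/distE; exists (2^-k).
apply: epsO => /=; have := dD x (e i) y; have := dD (e i) b y.
rewrite [dist x (e i)]dC [dist b y]dC; lra.
Qed.

(** * Pasting and exhaustion in stable sets; selections modulo null sets *)

Section representatives.
Context d (Omega : measurableType d) (P : probability Omega R).
Implicit Types (X : set (L0 P E)) (S T : Omega -> set E).

Lemma measurable_L0_open (x : L0 P E) (O : set E) : open O ->
  measurable [set w | O (L0_fun x w)].
Proof. exact: measurable_preimage_open. Qed.

Lemma ae_le_probability (A B : set Omega) : measurable A -> measurable B ->
  (\forall w \ae P, A w -> B w) -> (P A <= P B)%E.
Proof.
move=> mA mB [N [mN PN AN]].
rewrite -[leRHS]adde0 -PN; apply: le_trans (measureU2 P mB mN).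
apply: le_measure; rewrite ?inE//; first exact: measurableU.
move=> w Aw; have [Bw|nBw] := pselect (B w); first by left.
by right; apply: AN => /= /(_ Aw).
Qed.

(** The cover is turned into a partition by the first index, and stability is applied to that
    partition. *)
Lemma paste_cover X (C : nat -> set Omega) (x : nat -> L0 P E) : stable X ->
  (forall n, measurable (C n)) -> (forall w, exists n, C n w) ->
  (forall n, X (x n)) -> exists2 y, X y &
    \forall w \ae P, exists2 n, C n w & L0_fun y w = L0_fun (x n) w.
Proof.
move=> [_ stX] mC cC Xx; have [N [NC mN]] := measurable_first_index mC cC.
have pN : measurable_partition (fun n => [set w | N w = n]).
  split=> //; first by move=> i j _ _ [w [/= <- <-]].
  by apply/seteqP; split=> // w _; exists (N w).
have [y yN] := pasting_exists x pN; exists y; first exact: stX pN Xx yN.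
apply: filterS (ae_foralln yN) => w yw; exists (N w); first exact: NC.
exact: yw.
Qed.

Lemma paste_hitting X (O : set E) (x : nat -> L0 P E) : stable X -> open O ->
  (forall n, X (x n)) -> exists2 y, X y &
    \forall w \ae P, forall n, O (L0_fun (x n) w) -> O (L0_fun y w).
Proof.
move=> stX oO Xx.
(* Adding to each C n the event that no x m hits O makes C a cover. *)
pose C n := [set w | O (L0_fun (x n) w)] `|`
  ~` \bigcup_m [set w | O (L0_fun (x m) w)].
have [|w|y Xy yC] := paste_cover (C := C) stX _ _ Xx.
- move=> n; apply: measurableU; first exact: measurable_L0_open.
  apply: measurableC; apply: bigcupT_measurable => m.
  exact: measurable_L0_open.
- have [[m _ Om]|nO] := pselect ((\bigcup_m [set w | O (L0_fun (x m) w)]) w).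
    by exists m; left.
  by exists 0%N; right.
exists y => //; apply: filterS yC => w [n [Cn ->//|nC _ m Om]].
by exfalso; apply: nC; exists m.
Qed.

(** Pasting a maximizing sequence gives [z] attaining the supremum of [P (H x)] over [X]. Pasting
    [z] with any [v] in [X] would add the probability of [H v]\[H z], which must therefore
    vanish. *)
Lemma maximal_hitting X (O : set E) : stable X -> open O ->
  exists2 z, X z & forall x, X x ->
    \forall w \ae P, O (L0_fun x w) -> O (L0_fun z w).
Proof.
move=> stX oO; pose H (x : L0 P E) := [set w | O (L0_fun x w)].
have mH x : measurable (H x) by exact: measurable_L0_open.
pose m x := fine (P (H x)).
have mE x : P (H x) = (m x)%:E by rewrite fineK// fin_num_measure.
have supX : has_sup (m @` X).
  split; first by have [[x Xx] _] := stX; exists (m x), x.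
  by exists 1 => _ [x _ <-]; rewrite -lee_fin -mE; exact: probability_le1.
have le_sup x : X x -> m x <= sup (m @` X).
  by move=> Xx; apply: ub_le_sup; [case: supX | exists x].
have /choice[x xP] k : exists x, X x /\ sup (m @` X) - 2^-k < m x.
  have [|_ [x Xx <-] ?] := @sup_adherent R _ (2^-k) _ supX; last by exists x.
  by rewrite invr_gt0 exprn_gt0.
have [z Xz xz] := paste_hitting stX oO (fun k => proj1 (xP k)).
have mz : sup (m @` X) <= m z.
  apply/ler_addgt0Pr => eps eps0.
  have [//|k ke] := @exists_small_geometric R 1 eps _ eps0.
  have [_ xk] := xP k.
  have : m (x k) <= m z.
    rewrite -lee_fin -!mE; apply: ae_le_probability => //.
    by apply: filterS xz => w; exact.
  lra.
exists z => // v Xv.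
have [n|y Xy yzv] := paste_hitting (x := fun n => if n is 0%N then z else v)
  stX oO; first by case: n.
have mD : measurable (H v `\` H z) by exact: measurableD.
have : (P (H z `|` (H v `\` H z)) <= P (H y))%E.
  apply: ae_le_probability => //; first exact: measurableU.
  by apply: filterS yzv => w h [/(h 0%N)|[/(h 1%N)]].
have -> : P (H z `|` (H v `\` H z)) = (P (H z) + P (H v `\` H z))%E.
  by rewrite measureU// setDE setICA setICr setI0.
have DE : P (H v `\` H z) = (fine (P (H v `\` H z)))%:E.
  by rewrite fineK// fin_num_measure.
rewrite DE !mE -EFinD lee_fin => le_y.
have D0 : P (H v `\` H z) = 0%E.
  apply/eqP; rewrite eq_le measure_ge0 andbT.
  rewrite DE lee_fin.
  have := le_sup _ Xy; lra.
by exists (H v `\` H z); split=> // w /= /not_implyP.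
Qed.

(** [selections] asks for a representative with values in [S] everywhere. An almost sure selection
    is repaired by substituting [f] on the exceptional null set. *)
Lemma selectionsP S (f : {mfun Omega >-> borelType E}) (y : L0 P E) :
  (forall w, S w (f w)) ->
  selections P S y <-> \forall w \ae P, S w (L0_fun y w).
Proof.
move=> Sf; split=> [[g Sg <-]|[N [mN PN SN]]].
  by apply: filterS (L0_classK P g) => w /(_ I) ->.
have [g gE] : exists g : {mfun Omega >-> borelType E},
    forall w, (N w -> g w = f w) /\ (~ N w -> g w = L0_fun y w).
  pose g w : borelType E := if pselect (N w) then f w else L0_fun y w.
  have mg : measurable_fun setT g.
    apply: measurable_fun_borelP => O oO.
    rewrite (_ : _ @^-1` _ = (N `&` [set w | O (f w)]) `|`
        ([set w | O (L0_fun y w)] `\` N)).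
      apply: measurableU; first apply: measurableI => //.
        exact: measurable_preimage_open.
      by apply: measurableD => //; exact: measurable_L0_open.
    apply/seteqP; split=> w; rewrite /preimage /g /=; case: pselect => Nw.
    - by left.
    - by right.
    - by move=> [[]|[]].
    - by move=> [[]|[]].
  exists (mfun_Sub (mem_set mg)) => w; rewrite /= /g.
  by case: pselect.
exists g => [w|].
  have [Nw|nNw] := pselect (N w); first by have [-> //] := gE w.
  have [_ -> //] := gE w.
  by apply: contrapT => nS; apply: nNw; apply: SN.
apply: L0_fun_inj.
have yN : \forall w \ae P, ~ N w by exists N; split=> // w /= /contrapT.
apply: filterS2 (L0_classK P g) yN => w /(_ I) -> nNw _.
by have [_ ->] := gE w.
Qed.

Lemma selections_class S (f : {mfun Omega >-> borelType E}) :
  (forall w, S w (f w)) -> selections P S (L0_class P f).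
Proof. by exists f. Qed.

(** * The mapping associated with a stable and sequentially closed set *)

Lemma exists_mapping X : stable X -> seq_closed X ->
  exists S, closed_effros S /\ X = selections P S.
Proof.
move=> stX clX; have [B [oB Bbase]] := countable_base_closure.
have /choice[z zP] n : exists z, X z /\ forall x, X x ->
    \forall w \ae P, B n (L0_fun x w) -> B n (L0_fun z w).
  by have [z] := maximal_hitting stX (oB n); exists z.
pose S w := closure (range (fun n => L0_fun (z n) w : E)).
exists S.
have Sz n w : S w (L0_fun (z n) w) by apply: subset_closure; exists n.
have SE w O : open O -> S w `&` O !=set0 <-> exists n, O (L0_fun (z n) w).
  move=> oO; split=> [[y [Sy Oy]]|[n On]]; last by exists (L0_fun (z n) w).
  have [_ [[n _ <-]] On] := Sy O (open_nbhs_nbhs (conj oO Oy)).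
  by exists n.
split.
  split=> [w|w|O oO]; first exact: closed_closure.
    by exists (L0_fun (z 0%N) w).
  rewrite (_ : [set w | _] = \bigcup_n [set w | O (L0_fun (z n) w)]).
    by apply: bigcupT_measurable => n; exact: measurable_L0_open.
  apply/seteqP; split=> w /=; first by move/(SE _ _ oO) => [n]; exists n.
  by move=> [n _ On]; apply/SE => //; exists n.
apply/seteqP; split=> [x Xx|y [f Sf <-]].
  apply/(selectionsP (f := repr (z 0%N))); first exact: Sz.
  have /ae_foralln : forall n, \forall w \ae P,
      B n (L0_fun x w) -> B n (L0_fun (z n) w).
    by move=> n; apply: (proj2 (zP n)).
  (* Any base set containing [x] at [w] also contains [z n] at [w] for its index [n], so the value
     of [x] is adherent to those of the [z n]. *)
  apply: filterS => w xz; move=> O; rewrite nbhsE => -[U [oU Ux] UO].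
  have [n [Bx BU]] := Bbase U _ oU Ux.
  exists (L0_fun (z n) w); split; first by exists n.
  by apply: UO; apply: BU; apply: subset_closure; exact: xz.
(* The factor [2] comes from comparing [f w] and [z n] through a common centre [e i]; the countably
   many centres make the events [C n] measurable. *)
have /choice[x xP] k : exists x, X x /\
    \forall w \ae P, dist (f w) (L0_fun x w) < 2 * 2^-k.
  pose A i := [set y | dist (e i) y < 2^-k].
  have oA i : open (A i) by exact: open_dball.
  have r0 : 0 < 2^-k :> R by rewrite invr_gt0 exprn_gt0.
  pose C n := \bigcup_i ([set w | A i (f w)] `&`
    [set w | A i (L0_fun (z n) w)]).
  have [n|w|v Xv vC] := paste_cover (C := C) stX _ _ (fun n => proj1 (zP n)).
  - apply: bigcupT_measurable => i; apply: measurableI.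
      exact: measurable_preimage_open.
    exact: measurable_L0_open.
  - have [i fi] := dense_seq_near (f w) r0.
    have /SE[//|n zi] : S w `&` A i !=set0 by exists (f w).
    by exists n, i.
  exists v; split=> //; apply: filterS vC => w [n [i _ [/= fi vi]] ->].
  have := dD (f w) (e i) (L0_fun (z n) w).
  have : dist (e i) (f w) < 2^-k := fi.
  have : dist (e i) (L0_fun (z n) w) < 2^-k := vi.
  rewrite [dist (f w) (e i)]dC; lra.
apply: (clX x) => [k|]; first by have [] := xP k.
have /ae_foralln xf k := proj2 (xP k).
apply: filterS2 (L0_classK P f) xf => w /(_ I) -> xf.
apply/cvg_dist => eps eps0.
have [//|k ke] := @exists_small_geometric R 2 eps _ eps0.
exists k => n kn; apply: lt_trans (xf n) _; apply: le_lt_trans ke.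
rewrite ler_pM2l// lef_pV2 ?posrE ?exprn_gt0//.
by rewrite ler_eXn2l // ltr1n.
Qed.

(** * Recovering a mapping from its selections *)

Hypothesis dist_complete : complete_distance dist.

Lemma stable_selections S : closed_effros S -> stable (selections P S).
Proof.
move=> S_ce; have [f Sf] := measurable_selection dist_complete S_ce.
split; first by exists (L0_class P f); exact: selections_class.
move=> A x y [_ _ cA] Sx yA; apply/(selectionsP _ Sf).
have /ae_foralln Sxw : forall k, \forall w \ae P, S w (L0_fun (x k) w).
  by move=> k; apply/(selectionsP _ Sf).
apply: filterS2 Sxw (ae_foralln yA) => w Sxw yw.
have : setT w by []; rewrite -cA => -[k _ Ak].
by rewrite (yw k Ak).
Qed.

Lemma seq_closed_selections S : closed_effros S -> seq_closed (selections P S).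
Proof.
move=> S_ce; have [f Sf] := measurable_selection dist_complete S_ce.
move=> x y Sx xy; apply/(selectionsP _ Sf).
have /ae_foralln Sxw : forall k, \forall w \ae P, S w (L0_fun (x k) w).
  by move=> k; apply/(selectionsP _ Sf).
apply: filterS2 Sxw xy => w Sxw /cvg_dist xy; have [Scl _ _] := S_ce.
apply: closed_adherent => // eps /xy[N Nx].
by exists (L0_fun (x N) w); [exact: Sxw | exact: Nx].
Qed.

(** The selection theorem is applied to [S] cut down to [S w]&[B] where this is nonempty. Closed
    values require its closure, whence [closure B] in the conclusion. *)
Lemma selection_closure_hitting S (B : set E) : closed_effros S -> open B ->
  exists f : {mfun Omega >-> borelType E}, forall w, S w (f w) /\
    (S w `&` B !=set0 -> closure B (f w)).
Proof.
move=> [Scl S0 Sm] oB.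
pose T w := if pselect (S w `&` B !=set0) then closure (S w `&` B) else S w.
have [|f Tf] := measurable_selection (S := T) dist_complete.
  split=> [w|w|O oO]; rewrite /T.
  - by case: pselect => ?; [exact: closed_closure | exact: Scl].
  - case: pselect => [[x SBx]|?]; last exact: S0.
    by exists x; exact: subset_closure.
  (* An open [O] meets the closure of [S w]&[B] exactly when it meets [S w]&[B], so both cases
     reduce to hitting events of [S]. *)
  rewrite (_ : [set w | _] = [set w | S w `&` (B `&` O) !=set0] `|`
      ([set w | S w `&` O !=set0] `\` [set w | S w `&` B !=set0])).
    apply: measurableU; first by apply: Sm; exact: openI.
    by apply: measurableD; exact: Sm.
  apply/seteqP; split=> w /=; case: pselect => SB.
  - move=> [y [yc Oy]]; left.
    have [x [[Sx Bx] Ox]] := yc O (open_nbhs_nbhs (conj oO Oy)).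
    by exists x.
  - by right.
  - move=> [[x [Sx [Bx Ox]]]|[]//]; exists x; split=> //.
    exact: subset_closure.
  - by move=> [[x [Sx [Bx Ox]]]|[]//]; exists x.
exists f => w; have := Tf w; rewrite /T; case: pselect => // SB fw.
split; last by move=> _; apply: closureS fw => x [].
by apply: Scl; apply: closureS fw => x [].
Qed.

Lemma ae_subset_of_selections S T : closed_effros S -> closed_effros T ->
  selections P S `<=` selections P T -> \forall w \ae P, S w `<=` T w.
Proof.
move=> S_ce T_ce ST; have [g Tg] := measurable_selection dist_complete T_ce.
have [B [oB Bbase]] := countable_base_closure.
have /choice[f fP] n := selection_closure_hitting S_ce (oB n).
have /ae_foralln Tf : forall n, \forall w \ae P, T w (f n w).
  move=> n; have /ST : selections P S (L0_class P (f n)).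
    by apply: selections_class => w; have [] := fP n w.
  move=> /(selectionsP _ Tg); apply: filterS2 (L0_classK P (f n)) => w.
  by move=> /(_ I) ->.
apply: filterS Tf => w Tf s Ss; apply: contrapT => nTs.
have [Tcl _ _] := T_ce.
(* A point [s] of [S w] outside [T w] has a base neighbourhood whose closure avoids [T w], yet
   [f n w] would lie in both. *)
have [n [Bs BT]] := Bbase (~` T w) s (closed_openC (Tcl w)) nTs.
have [_ /(_ (ex_intro _ s (conj Ss Bs))) /BT] := fP n w.
by apply; exact: Tf.
Qed.

End representatives.

End dense_sequence.

End metric.

(** * The two reciprocality relations *)

Theorem theorem5p3 (R : realType) (d : measure_display)
    (Omega : measurableType d) (P : probability Omega R)
    (E : ptopologicalType)
    (P_complete : measure_is_complete P) (E_polish : polish R E) :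
  exists SX : set (L0 P E) -> Omega -> set E,
    (forall X : set (L0 P E), stable X -> seq_closed X ->
       closed_effros (SX X) /\ X = selections P (SX X)) /\
    (forall S : Omega -> set E, closed_effros S ->
       [/\ stable (selections P S), seq_closed (selections P S) &
           S = SX (selections P S) %[ae P]]).
Proof.
have [/separable_dense_seq[e e_dense] [dist [distP distE dist_complete]]] :=
  E_polish.
have /choice[SX SXP] (X : set (L0 P E)) : exists S : Omega -> set E,
    stable X -> seq_closed X -> closed_effros S /\ X = selections P S.
  have [[stX clX]|nX] := pselect (stable X /\ seq_closed X).
    by have [S] := exists_mapping distP distE e_dense stX clX; exists S.
  (* An arbitrary value for sets [X] about which nothing is claimed. *)
  by exists (fun=> setT) => stX clX; exfalso; apply: nX.
exists SX; split=> // S S_ce.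
have stS : stable (selections P S).
  exact: (stable_selections distP distE e_dense P dist_complete S_ce).
have clS : seq_closed (selections P S).
  exact: (seq_closed_selections distP distE e_dense dist_complete S_ce).
split=> //; have [T_ce ST] := SXP _ stS clS.
(* By [ST], [S] and the mapping associated with its selections have the same selections, so the
   comparison lemma applies in both directions. *)
have subST : \forall w \ae P, S w `<=` SX (selections P S) w.
  apply: (ae_subset_of_selections distP distE e_dense dist_complete S_ce T_ce).
  by rewrite -ST.
have subTS : \forall w \ae P, SX (selections P S) w `<=` S w.
  apply: (ae_subset_of_selections distP distE e_dense dist_complete T_ce S_ce).
  by rewrite -ST.
by apply: filterS2 subST subTS => w ST_w TS_w _; apply/seteqP.
Qed.
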